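(* Let $\mathcal{H}$ be a real Hilbert space, let $\mathcal{Z} \subseteq \mathcal{H}$ be a closed convex set with $0 \in \mathcal{Z}$, and let $T \in (0,\infty)$. Assume that $u \in BV([0,T];\mathcal{H})$ is left continuous on $[0,T]$ (i.e. $u(t-)=u(t)$ for all $t \in [0,T]$) and that $z_0 \in \mathcal{Z}$. Let $y \in BV([0,T];\mathcal{H})$ be the unique function satisfying (1) $u(t) - y(t) \in \mathcal{Z}$ for all $t \in [0,T]$; (2) $\displaystyle\int_{\mathrm{Cont}(u)} \langle z(t) - u(t) + y(t), \,d\mathrm{D}y(t)\rangle \le 0$ for every $z \in L^\infty([0,T];\mathcal{H})$ with $z([0,T]) \subseteq \mathcal{Z}$; (3) $u(t) - y(t) = \mathrm{Proj}_{\mathcal{Z}}(u(t) - y(t-))$ for all $t \in \mathrm{Discont}(u) \setminus \{0\}$; (4) $u(t+) - y(t+) = \mathrm{Proj}_{\mathcal{Z}}(u(t+) - y(t))$ for all $t \in \mathrm{Discont}(u)$; (5) $u(0) - y(0) = z_0$. Then $y$ is left continuous and (a) $u(t) - y(t) \in \mathcal{Z}$ for all $t \in [0,T]$; (b) $\displaystyle\int_{[0,T]} \langle z(t) - u(t+) + y(t+), \,d\mathrm{D}y(t)\rangle \le 0$ for every $z \in L^\infty([0,T];\mathcal{H})$ with $z([0,T]) \subseteq \mathcal{Z}$; (c) $u(0) - y(0) = z_0$.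
   Context: $\mathcal{H}$ has inner product $\langle\cdot,\cdot\rangle$ and norm $\|\cdot\|$. For $f:[0,T]\to\mathcal{H}$ (pointwise defined; functions are not identified when equal a.e.) the pointwise variation is $V(f,[0,T]) = \sup \sum_{j=1}^m \|f(t_j)-f(t_{j-1})\|$ over all $m\ge 1$ and $t_0<\dots<t_m$ in $[0,T]$; $BV([0,T];\mathcal{H})$ is the set of $f$ with $V(f,[0,T])<\infty$. Such $f$ has one-sided limits $f(t-)$, $f(t+)$ at every $t\in[0,T]$, with the convention $f(0-):=f(0)$ and $f(T+):=f(T)$. $\mathrm{Cont}(f)$ is the set of continuity points of $f$ in $[0,T]$ and $\mathrm{Discont}(f)=[0,T]\setminus\mathrm{Cont}(f)$. $\mathrm{Proj}_{\mathcal{Z}}(x)$ is the unique point of $\mathcal{Z}$ nearest to $x$. For $f\in BV([0,T];\mathcal{H})$, $\mathrm{D}f$ denotes its differential (Lebesgue-Stieltjes) measure: the unique $\mathcal{H}$-valued measure of bounded variation on $[0,T]$ with $\mathrm{D}f((c,d))=f(d-)-f(c+)$, $\mathrm{D}f([c,d])=f(d+)-f(c-)$, $\mathrm{D}f([c,d))=f(d-)-f(c-)$, $\mathrm{D}f((c,d])=f(d+)-f(c+)$ for $c<d$ in $[0,T]$ (so $\mathrm{D}f(\{t\})=f(t+)-f(t-)$). For an $\mathcal{H}$-valued measure $\mu$ with bounded variation and total variation measure $|\mu|$, the integral $\int\langle g,d\mu\rangle\in\mathbb{R}$ is defined for simple functions $g=\sum_j \mathbf{1}_{A_j} g_j$ ($A_j$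 disjoint measurable, $g_j\in\mathcal{H}$) by $\sum_j\langle g_j,\mu(A_j)\rangle$ and extended by continuity to $g\in L^1(|\mu|;\mathcal{H})$; $\int_B\langle g,d\mu\rangle := \int\langle\mathbf{1}_B g,d\mu\rangle$. $L^\infty([0,T];\mathcal{H})$ denotes the bounded strongly Borel measurable functions $z:[0,T]\to\mathcal{H}$ (everywhere defined). Existence and uniqueness of $y\in BV([0,T];\mathcal{H})$ satisfying (1)-(5) holds for every $u\in BV([0,T];\mathcal{H})$ and $z_0\in\mathcal{Z}$ (another theorem of the paper).
   Formalization: Conditions (1)-(5) do not determine y (e.g. Z=[-1,1], u=0, z_0=1: y=-1 may be altered at one interior point), so the formal theorem assumes that y satisfies (1)-(5) and either is literally the only solution or is continuous wherever u is (Cont(u) ⊆ Cont(y)). *)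

(* Defs.v *)
From HB Require Import structures.
From mathcomp Require Import all_boot all_order all_algebra.
From mathcomp Require Import all_classical all_reals all_analysis.

Set Implicit Arguments.
Unset Strict Implicit.
Unset Printing Implicit Defensive.

Import Order.TTheory GRing.Theory Num.Theory.
Import numFieldNormedType.Exports.

Local Open Scope classical_set_scope.
Local Open Scope ring_scope.

(* A real Hilbert space is a complete normed space whose norm is induced by a
   symmetric positive definite bilinear form. *)
Definition norm_induced_by (R : realType) (H : completeNormedModType R)
    (dot : {dot H for (@idfun R)}) : Prop :=
  forall x : H, `|x| ^+ 2 = dot x x.

(* [Proj Z x] is meaningful when the nearest point exists and is unique, which
   is the case for a nonempty closed convex subset of a Hilbert space. *)
Definition Proj (R : realType) (H : completeNormedModType R)
    (Z : set H) (x : H) : H :=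
  xget 0 [set p | Z p /\ forall q, Z q -> `|x - p| <= `|x - q|].

(** Functions on [0, T] are represented by functions on the whole of R, of which
    only the restriction to [0, T] is ever used. *)
Section functions.
Context (R : realType) (H : completeNormedModType R).
Implicit Types (f : R -> H) (a b t T : R).

Definition pointwise_variation f a b : \bar R :=
  ereal_sup [set v | exists (m : nat) (p : nat -> R),
    [/\ (0 < m)%N,
        (forall j, (j < m)%N -> p j < p j.+1),
        (forall j, (j <= m)%N -> p j \in `[a, b]) &
        v = (\sum_(j < m) `|f (p j.+1) - f (p j)|)%:E]].

Definition BV T f : Prop := (pointwise_variation f 0 T < +oo)%E.

Definition left_lim f t : H :=
  if t == 0 then f t else lim (f x @[x --> t^'-]).

Definition right_lim T f t : H :=
  if t == T then f t else lim (f x @[x --> t^'+]).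

Definition left_continuous T f : Prop :=
  forall t, t \in `[0, T] -> left_lim f t = f t.

Definition Cont T f : set R :=
  [set t | t \in `[0, T] /\ f x @[x --> within `[0, T] (nbhs t)] --> f t].

Definition Discont T f : set R := `[0, T] `\` Cont T f.

End functions.

Section vector_measures.
Context (R : realType) (H : completeNormedModType R).
Context d (X : measurableType d).
Implicit Types (mu : set X -> H) (A : set X) (g : X -> H).

Definition vector_measure mu : Prop :=
  forall F : nat -> set X, (forall n, measurable (F n)) -> trivIset setT F ->
    (\sum_(i < n) mu (F i)) @[n --> \oo] --> mu (\bigcup_n F n).

Definition vtotal_variation mu A : \bar R :=
  ereal_sup [set v | exists (n : nat) (F : 'I_n -> set X),
    [/\ (forall i, measurable (F i)), trivIset setT F, \bigcup_i F i = A &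
        v = (\sum_(i < n) `|mu (F i)|)%:E]].

Record vsimple := VSimple {
  vs_size : nat ;
  vs_set : 'I_vs_size -> set X ;
  vs_val : 'I_vs_size -> H ;
  vs_measurable : forall j, measurable (vs_set j) ;
  vs_disjoint : trivIset setT vs_set }.

Definition vsimple_fun (s : vsimple) : X -> H :=
  fun x => \sum_(j < vs_size s) (\1_(vs_set j) x : R) *: vs_val j.

Definition strongly_measurable A g : Prop :=
  exists s : nat -> vsimple,
    forall x, A x -> vsimple_fun (s n) x @[n --> \oo] --> g x.

Definition vL1 mu g : Prop :=
  strongly_measurable setT g /\
  (\int[vtotal_variation mu]_x (`|g x|)%:E < +oo)%E.

Definition vsimple_integral (dot : {dot H for (@idfun R)}) mu (s : vsimple) : R :=
  \sum_(j < vs_size s) dot (vs_val j) (mu (vs_set j)).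

(* The integral of <g, dmu>: the extension by continuity of [vsimple_integral]
   from simple functions to L^1(|mu|; H), with the dummy value 0 for g outside
   of L^1(|mu|; H). *)
Definition vintegral (dot : {dot H for (@idfun R)}) mu g : R :=
  xget 0 [set I | vL1 mu g /\ exists s : nat -> vsimple,
    (\int[vtotal_variation mu]_x (`|vsimple_fun (s n) x - g x|)%:E
       @[n --> \oo] --> 0)%E /\
    vsimple_integral dot mu (s n) @[n --> \oo] --> I].

Definition vintegral_on (dot : {dot H for (@idfun R)}) mu A g : R :=
  vintegral dot mu (fun x => (\1_A x : R) *: g x).

End vector_measures.

Section differential_measure.
Context (R : realType) (H : completeNormedModType R).
Implicit Types (f z : R -> H) (T : R).

(* The Borel sets of R being used throughout, a measure on [0, T] is represented
   by its extension by zero, i.e. by a measure on R concentrated on [0, T]. *)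
Definition differential_measure T f (mu : set (measurableTypeR R) -> H) : Prop :=
  [/\ vector_measure mu,
      (vtotal_variation mu setT < +oo)%E,
      (forall A : set (measurableTypeR R), measurable A ->
         mu A = mu (A `&` `[0, T])) &
      forall c e : R, c \in `[0, T] -> e \in `[0, T] -> c < e ->
        [/\ mu `]c, e[%classic = left_lim f e - right_lim T f c,
            mu `[c, e]%classic = right_lim T f e - left_lim f c,
            mu `[c, e[%classic = left_lim f e - left_lim f c &
            mu `]c, e]%classic = right_lim T f e - right_lim T f c]].

Definition Linfty T z : Prop :=
  strongly_measurable (X := measurableTypeR R) `[0, T] z /\
  exists M : R, forall t, t \in `[0, T] -> `|z t| <= M.

End differential_measure.

Section evolution_problem.
Context (R : realType) (H : completeNormedModType R).
Context (dot : {dot H for (@idfun R)}) (Z : set H) (T : R) (u : R -> H) (z0 : H).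

Definition solution (y : R -> H) (Dy : set (measurableTypeR R) -> H) : Prop :=
  [/\ (forall t : R, t \in `[0, T] -> Z (u t - y t)),
      (forall z : R -> H,
        Linfty T z -> (forall t : R, t \in `[0, T] -> Z (z t)) ->
        vintegral_on dot Dy (Cont T u) (fun t : R => z t - u t + y t) <= 0),
      (forall t : R, Discont T u t -> t != 0 ->
        u t - y t = Proj Z (u t - left_lim y t)),
      (forall t : R, Discont T u t ->
        right_lim T u t - right_lim T y t = Proj Z (right_lim T u t - y t)) &
      u 0 - y 0 = z0].

(* [solution] alone does not determine y at the continuity points of u: with
   Z = [-1, 1] in the real line, u = 0 and z0 = 1, it holds for the constant
   y = -1, for that function altered at one interior point, and for the function
   equal to -1 at 0 and to 0 elsewhere.  The function usually meant by "the
   solution" is the one that jumps only where u does, i.e. the one satisfying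
   [Cont T u `<=` Cont T y]; when Z is not reduced to 0, no solution is the only
   one. *)
Definition only_solution (y : R -> H) : Prop :=
  forall (y' : R -> H) (Dy' : set (measurableTypeR R) -> H),
    BV T y' -> differential_measure T y' Dy' -> solution y' Dy' ->
    forall t : R, t \in `[0, T] -> y' t = y t.

End evolution_problem.

(* Main.v *)
Require Import Defs.
From HB Require Import structures.
From mathcomp Require Import all_boot all_order all_algebra.
From mathcomp Require Import all_classical all_reals all_analysis.
From mathcomp Require Import measurable_realfun.
From mathcomp Require Import ring lra.

Set Implicit Arguments.
Unset Strict Implicit.
Unset Printing Implicit Defensive.

Import Order.TTheory GRing.Theory Num.Theory.
Import numFieldNormedType.Exports.

Local Open Scope classical_set_scope.
Local Open Scope ring_scope.

(** The two integrals in the hypothesis and in the conclusion differ only on the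
    set D of discontinuity points of u.  Off D, both u and y are continuous, so
    that u(t+) = u(t) and y(t+) = y(t), and the integrands agree.  The set D is
    countable, so its contribution is the sum over t in D of
      < z(t) - u(t+) + y(t+) , Dy({t}) >,   Dy({t}) = y(t+) - y(t-).
    Left continuity of y turns Dy({t}) into y(t+) - y(t), and since
    u(t+) - y(t+) is the projection of u(t+) - y(t) on Z, each term is
    nonpositive: it is the obtuse angle inequality of the projection
    ([Proj_obtuse]).  Left continuity itself comes from the jump condition at t:
    u(t) - y(t-) is a limit of points of Z, hence is its own projection, and
    u(t) - y(t) = u(t) - y(t-) ([solution_left_continuous]).

    All this supposes that y jumps only where u does.  When y is instead known
    to be the only solution, that property follows because the problem is
    insensitive to the value of y at a point a of continuity of u where Dy has
    no atom: unless Z = {0}, in which case y = u, moving y(a) so that u(a) - y(a)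
    becomes another point of Z yields a second solution
    ([only_solution_Cont_subset]).

    The integral against a vector measure mu is only given as a limit along some
    approximating sequence of simple functions, so most of the work is to make it
    usable.  The total variation |mu| is shown to be a measure, the estimate
    |int <s, dmu>| <= int |s| d|mu| is proved for step functions
    ([step_integral_le]), and from it follow uniqueness of the integral, its
    additivity when the domain is cut in two ([vintegral_split]), its value on a
    point, and, by dominated convergence, its sign on a countable set
    ([vintegral_countable_le0]). *)

(** * Inner product and projection on a closed convex set *)

Section inner_product.
Context (R : realType) (H : completeNormedModType R).
Context (dot : {dot H for (@idfun R)}).
Implicit Types x y z : H.

Lemma dotC x y : dot x y = dot y x.
Proof. by have := hermC dot x y; rewrite expr0 mul1r. Qed.

Lemma dotDl x y z : dot (x + y) z = dot x z + dot y z.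
Proof. exact: linearDl. Qed.

Lemma dotZl (a : R) x z : dot (a *: x) z = a * dot x z.
Proof. exact: linearZl_LR. Qed.

Lemma dotDr x y z : dot z (x + y) = dot z x + dot z y.
Proof. by rewrite dotC dotDl !(dotC z). Qed.

Lemma dotZr (a : R) x z : dot z (a *: x) = a * dot z x.
Proof. by rewrite dotC dotZl dotC. Qed.

Lemma dotNl x z : dot (- x) z = - dot x z.
Proof. by rewrite -scaleN1r dotZl mulN1r. Qed.

Lemma dotNr x z : dot z (- x) = - dot z x.
Proof. by rewrite dotC dotNl dotC. Qed.

Lemma dot0l z : dot 0 z = 0.
Proof. by rewrite -(scale0r 0) dotZl mul0r. Qed.

Lemma dot0r z : dot z 0 = 0.
Proof. by rewrite dotC dot0l. Qed.

Definition dot_bilinear := (dotDl, dotDr, dotZl, dotZr, dotNl, dotNr).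

Hypothesis dotE : norm_induced_by dot.

Lemma norm_dotB x y : `|x - y| ^+ 2 = `|x| ^+ 2 - 2 * dot x y + `|y| ^+ 2.
Proof. by rewrite !dotE !dot_bilinear (dotC y x); ring. Qed.

Lemma CauchySchwarz_dot x y : `|dot x y| <= `|x| * `|y|.
Proof.
rewrite -(@ler_pXn2r _ 2) ?nnegrE ?mulr_ge0// exprMn real_normK ?num_real//.
have [->|y0] := eqVneq y 0; first by rewrite dot0r expr0n/= mulr_ge0 ?sqr_ge0.
have n0 : 0 < `|y| ^+ 2 by rewrite exprn_gt0 ?normr_gt0.
rewrite -(ler_pM2r n0) -subr_ge0.
suff -> : `|x| ^+ 2 * `|y| ^+ 2 * `|y| ^+ 2 - dot x y ^+ 2 * `|y| ^+ 2 =
   `| `|y| ^+ 2 *: x - dot x y *: y| ^+ 2 by exact: sqr_ge0.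
by rewrite !dotE !dot_bilinear (dotC y x); ring.
Qed.

Lemma parallelogram x y z :
  `|x - y| ^+ 2 =
  2 * `|z - x| ^+ 2 + 2 * `|z - y| ^+ 2 - 4 * `|z - (2^-1 *: x + 2^-1 *: y)| ^+ 2.
Proof. by rewrite !dotE !dot_bilinear !(dotC y) !(dotC x z); field. Qed.

End inner_product.

Section projection.
Context (R : realType) (H : completeNormedModType R).
Context (dot : {dot H for (@idfun R)}) (dotE : norm_induced_by dot).
Context (Z : set H) (Zclosed : closed Z) (Zconvex : convex_set Z).

Lemma convex_comb (p q : H) (a : R) : Z p -> Z q -> 0 <= a -> a <= 1 ->
  Z (a *: p + (1 - a) *: q).
Proof.
move=> Zp Zq a0 a1; have a01 : Itv.spec (@Itv.num_sem R) (Itv.Real `[0%Z, 1%Z]) a.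
  rewrite /Itv.spec /Itv.num_sem/= num_real /= in_itv/= a0 a1//.
by have /set_mem := Zconvex (Itv.mk a01) (mem_set Zp) (mem_set Zq).
Qed.

(** A minimizing sequence is Cauchy by the parallelogram identity, because the
    midpoint of two points of Z is again in Z and so at distance at least the
    infimum from x. *)
Lemma nearest_point_exists (x : H) : Z !=set0 ->
  exists p, Z p /\ forall q, Z q -> `|x - p| <= `|x - q|.
Proof.
move=> [q0 Zq0].
pose E := [set `|x - q| ^+ 2 | q in Z].
have Einf : has_inf E.
  by split; [exists (`|x - q0| ^+ 2), q0|exists 0 => _ [q _ <-]; exact: sqr_ge0].
pose m := inf E.
have mle q : Z q -> m <= `|x - q| ^+ 2.
  by move=> Zq; apply: ge_inf; [exact: (proj2 Einf)|exists q].
have near_min n : exists q, Z q /\ `|x - q| ^+ 2 < m + n.+1%:R^-1.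
  have [_ [q Zq <-] qm] := @inf_adherent _ E n.+1%:R^-1 ltac:(by rewrite invr_gt0) Einf.
  by exists q.
have [q qP] := choice near_min.
have cauchy_q : cauchy (q @ \oo).
  apply: cauchy_exP => e e0.
  have [N N1] : exists N : nat, N.+1%:R^-1 < e ^+ 2 / 4.
    have e4 : 0 < e ^+ 2 / 4 by rewrite divr_gt0// exprn_gt0.
    by have [k] := ltr_add_invr e4; rewrite add0r => ke; exists k.
  exists (q N); exists N => // n /= Nn; rewrite -ball_normE/=.
  rewrite -(@ltr_pXn2r _ 2) ?nnegrE ?normr_ge0 ?(ltW e0)//.
  rewrite (parallelogram dotE (q N) (q n) x).
  have mid : m <= `|x - (2^-1 *: q N + 2^-1 *: q n)| ^+ 2.
    apply: mle; have -> : (2^-1 : R) *: q n = (1 - 2^-1) *: q n.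
      by congr (_ *: _); field.
    by apply: convex_comb; [exact: (qP N).1|exact: (qP n).1|lra|lra].
  have := (qP N).2; have := (qP n).2.
  have : n.+1%:R^-1 <= N.+1%:R^-1 :> R by rewrite lef_pV2 ?posrE// ler_nat.
  move: N1 mid; move: (n.+1%:R^-1) (N.+1%:R^-1) (e ^+ 2) (`|x - q n| ^+ 2)
    (`|x - q N| ^+ 2) (`|x - (2^-1 *: q N + 2^-1 *: q n)| ^+ 2) => *.
  lra.
have /cauchy_cvg/cvg_ex[p qp] := cauchy_q.
exists p; split.
  by apply: (closed_cvg Z) (qp) => //; apply: nearW => n; exact: (qP n).1.
have pm : `|x - p| ^+ 2 <= m.
  apply/ler_addgt0Pr => e e0.
  have : `|x - q n| ^+ 2 @[n --> \oo] --> `|x - p| ^+ 2.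
    by apply: cvgM; apply: cvg_norm; apply: cvgB => //; exact: cvg_cst.
  move=> /cvgr_to_le; apply.
  have [N Ne] := ltr_add_invr e0.
  exists N => // n /= Nn; apply/ltW/(lt_le_trans (qP n).2).
  rewrite lerD2l (le_trans _ (ltW Ne))// add0r.
  by rewrite lef_pV2 ?posrE// ler_nat.
move=> r Zr; rewrite -(@ler_pXn2r _ 2) ?nnegrE//.
exact: le_trans pm (mle _ Zr).
Qed.

Lemma Proj_nearest (x : H) : Z !=set0 ->
  Z (Proj Z x) /\ forall q, Z q -> `|x - Proj Z x| <= `|x - q|.
Proof.
move=> /(nearest_point_exists x) near.
exact: (@xgetPex H 0 _ near).
Qed.

Lemma Proj_id (x : H) : Z x -> Proj Z x = x.
Proof.
move=> Zx; have [_ /(_ x Zx)] := Proj_nearest x (ex_intro _ x Zx).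
by rewrite subrr normr0 normr_le0 subr_eq0 => /eqP.
Qed.

(** Moving from the projection p towards z by a small fraction t stays in Z and
    cannot decrease the distance to x; the first order term in t of that
    squared distance has to be nonnegative. *)
Lemma Proj_obtuse (x z : H) : Z z -> dot (x - Proj Z x) (z - Proj Z x) <= 0.
Proof.
move=> Zz; have [Zp pmin] := Proj_nearest x (ex_intro _ z Zz).
set p := Proj Z x in Zp pmin *.
set a := dot _ _; set b := `|z - p| ^+ 2.
have key (t : R) : 0 < t -> t <= 1 -> 2 * a <= t * b.
  move=> t0 t1.
  have : `|x - p| ^+ 2 <= `|x - (t *: z + (1 - t) *: p)| ^+ 2.
    by rewrite ler_pXn2r ?nnegrE//; apply: pmin; exact: convex_comb (ltW t0) t1.
  have -> : x - (t *: z + (1 - t) *: p) = (x - p) - t *: (z - p).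
    by rewrite scalerBl scale1r scalerBr addrCA opprD addrA.
  rewrite (norm_dotB dotE (x - p)) (dotE (t *: _)) !dotZr dotZl -dotE -/a -/b.
  rewrite -addrA lerDl => h; rewrite -subr_ge0 -(pmulr_rge0 _ t0).
  by apply: (le_trans h); rewrite le_eqVlt; apply/predU1P; left; ring.
rewrite leNgt; apply/negP => a0.
have b0 : 0 <= b by exact: sqr_ge0.
have t0 : 0 < Num.min 1 (a / (b + 1)).
  by rewrite lt_min ltr01 divr_gt0// ltr_wpDl.
(* This t is small enough for t * b <= a, which contradicts 2 * a <= t * b. *)
have := key _ t0 ltac:(by rewrite ge_min lexx).
have : Num.min 1 (a / (b + 1)) * b <= a.
  apply: (@le_trans _ _ (a / (b + 1) * b)).
    by rewrite ler_wpM2r// ge_min lexx orbT.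
  by rewrite mulrAC ler_pdivrMr ?ltr_wpDl// ler_pM2l// lerDl.
lra.
Qed.

End projection.

(** * The total variation of a vector measure *)

Section vector_measure.
Context (R : realType) (H : completeNormedModType R).
Context d (X : measurableType d).
Context (mu : set X -> H) (vmu : vector_measure mu).
Implicit Types A B : set X.

(** Consecutive partial sums of the constant series mu(set0) differ by
    mu(set0), and they converge. *)
Lemma vmeasure0 : mu set0 = 0.
Proof.
have c : (fun n => \sum_(i < n) mu set0) @ \oo --> mu set0.
  have := @vmu (fun=> set0) (fun=> measurable0).
  by rewrite bigcup0//; apply; apply/trivIsetP => i j _ _ _; rewrite set0I.
have c1 : (fun n => \sum_(i < n.+1) mu set0) @ \oo --> mu set0.
  by rewrite (cvg_shiftS (fun n => \sum_(i < n) mu set0)).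
have := cvgB c1 c; rewrite subrr.
rewrite (_ : _ - _ = cst (mu set0)).
  by move=> c0; apply: norm_cvg_unique (c0 _); exact: cvg_cst.
by apply/funext => n; rewrite !fctE/= big_ord_recr/= addrC addKr.
Qed.

Lemma vmeasure_additive n (F : nat -> set X) :
  (forall i, measurable (F i)) -> trivIset setT F ->
  mu (\big[setU/set0]_(i < n) F i) = \sum_(i < n) mu (F i).
Proof.
move=> mF tF.
pose G i := if (i < n)%N then F i else set0.
have -> : \big[setU/set0]_(i < n) F i = \bigcup_i G i.
  rewrite -bigcup_mkord; apply/seteqP; split=> [x [i /= ni Fx]|x [i _]].
    by exists i => //; rewrite /G ni.
  by rewrite /G; case: ifPn => // ni Fx; exists i.
have mG i : measurable (G i) by rewrite /G; case: ifPn.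
have tG : trivIset setT G.
  move=> i j _ _; rewrite /G; case: ifPn => _; case: ifPn => _ [x []]// Fi Fj.
  by apply: tF => //; exists x.
have cG := vmu mG tG.
apply: (norm_cvg_unique cG).
apply: cvg_near_cst; exists n => // m /= nm.
rewrite -(subnKC nm) big_split_ord/= [X in _ + X]big1 ?addr0.
  by apply: eq_bigr => i _; rewrite /G ltn_ord.
by move=> i _; rewrite /G ltnNge leq_addr/= vmeasure0.
Qed.

Lemma vmeasureU A B : measurable A -> measurable B -> A `&` B = set0 ->
  mu (A `|` B) = mu A + mu B.
Proof.
move=> mA mB AB; have := @vmeasure_additive 2 (bigcup2 A B).
rewrite !big_ord_recr !big_ord0/= set0U add0r; apply.
  by move=> [|[|i]]/=.
by move=> [|[|i]] [|[|j]]//= _ _ [x []]// Ax Bx; have : (A `&` B) x by []; rewrite AB.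
Qed.

Lemma vmeasure_setID A B : measurable A -> measurable B ->
  mu A = mu (A `&` B) + mu (A `\` B).
Proof.
move=> mA mB; rewrite -vmeasureU ?setUIDK//.
- exact: measurableI.
- exact: measurableD.
- by rewrite setDE setIACA setICr setI0.
Qed.

Local Notation tv := (vtotal_variation mu).

Lemma vtv_partition n (F : 'I_n -> set X) A :
  (forall i, measurable (F i)) -> trivIset setT F -> \bigcup_i F i = A ->
  ((\sum_(i < n) `|mu (F i)|)%:E <= tv A)%E.
Proof. by move=> mF tF FA; apply: ereal_sup_ubound; exists n, F. Qed.

Lemma vmeasure_le_vtv A : measurable A -> (`|mu A|%:E <= tv A)%E.
Proof.
move=> mA; have := @vtv_partition 1 (fun=> A) A (fun=> mA).
rewrite big_ord1; apply; first by move=> i j _ _ _; rewrite !ord1.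
by rewrite bigcup_const//; exists ord0.
Qed.

Lemma vtv_ge0 A : measurable A -> (0 <= tv A)%E.
Proof. by move=> mA; apply: le_trans (vmeasure_le_vtv mA); rewrite lee_fin. Qed.

Lemma vtv0 : tv set0 = 0%E.
Proof.
apply/eqP; rewrite eq_le vtv_ge0// andbT; apply: ge_ereal_sup => _ [n [F [_ _ F0 ->]]].
rewrite lee_fin big1// => i _; have -> : F i = set0.
  by apply/seteqP; split => // x Fx; rewrite -F0; exists i.
by rewrite vmeasure0 normr0.
Qed.

(** Partitions of A and of B are put side by side into one of their union.  The
    case of an infinite variation of A is separate, as no subtraction is then
    possible. *)
Lemma le_vtvU A B : measurable A -> measurable B -> A `&` B = set0 ->
  (tv A + tv B <= tv (A `|` B))%E.
Proof.
move=> mA mB AB.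
have join b : [set v | exists (n : nat) (G : 'I_n -> set X),
    [/\ (forall i, measurable (G i)), trivIset setT G, \bigcup_i G i = B &
        v = (\sum_(i < n) `|mu (G i)|)%:E]] b -> (tv A + b <= tv (A `|` B))%E.
  move=> [n [G [mG tG GB ->]]]; rewrite -leeBrDr//.
  apply: ge_ereal_sup => _ [m [F [mF tF FA ->]]]; rewrite leeBrDr// -EFinD.
  pose K (i : 'I_(m + n)) := match fintype.split i with inl j => F j | inr k => G k end.
  have KF j : K (lshift n j) = F j by rewrite /K (unsplitK (inl j)).
  have KG k : K (rshift m k) = G k by rewrite /K (unsplitK (inr k)).
  have -> : \sum_(i < m) `|mu (F i)| + \sum_(i < n) `|mu (G i)| =
      \sum_(i < m + n) `|mu (K i)|.
    by rewrite big_split_ord/=; congr (_ + _); apply: eq_bigr => i _;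
      rewrite ?KF ?KG.
  have noAB x i j : F i x -> G j x -> False.
    move=> Fx Gx; have : (A `&` B) x by rewrite -FA -GB; split; [exists i|exists j].
    by rewrite AB.
  apply: vtv_partition.
  - by move=> i; rewrite /K; case: (fintype.split i).
  - move=> i j _ _; case: (split_ordP i) => i' ->; case: (split_ordP j) => j' ->;
      rewrite ?KF ?KG => -[x [h1 h2]].
    + by congr lshift; apply: tF => //; exists x.
    + by case: (noAB x i' j').
    + by case: (noAB x j' i').
    + by congr rshift; apply: tG => //; exists x.
  - rewrite -FA -GB; apply/seteqP; split=> [x [i _]|x [[i _ h]|[i _ h]]].
    + case: (split_ordP i) => i' ->; rewrite ?KF ?KG => h;
        by [left; exists i'|right; exists i'].
    + by exists (lshift n i) => //; rewrite KF.
    + by exists (rshift m i) => //; rewrite KG.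
have [/fineK tAE|] := boolP (tv A \is a fin_num).
  rewrite -tAE -leeBrDl//; apply: ge_ereal_sup => b bB.
  by rewrite leeBrDl// tAE; exact: join.
rewrite ge0_fin_numE ?vtv_ge0// -leNgt leye_eq => /eqP tA.
have := join `|mu B|%:E; rewrite tA addye// leye_eq => /(_ _)/eqP -> //.
  by rewrite leey.
exists 1, (fun=> B); split=> //; last by rewrite big_ord1.
  by move=> i j _ _ _; rewrite !ord1.
by rewrite bigcup_const//; exists ord0.
Qed.

(** A partition of the union is cut by A and by B. *)
Lemma vtvU_le A B : measurable A -> measurable B -> A `&` B = set0 ->
  (tv (A `|` B) <= tv A + tv B)%E.
Proof.
move=> mA mB AB; apply: ge_ereal_sup => _ [n [F [mF tF FAB ->]]].
have sub (C : set X) : measurable C -> C `<=` A `|` B ->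
    ((\sum_(i < n) `|mu (F i `&` C)|)%:E <= tv C)%E.
  move=> mC CAB; apply: vtv_partition.
  - by move=> i; exact: measurableI.
  - exact: trivIset_setIr.
  - by rewrite -setI_bigcupl FAB; apply/setIidPr.
apply: le_trans (leeD (sub A mA (@subsetUl _ A B)) (sub B mB (@subsetUr _ A B))).
rewrite -EFinD lee_fin -big_split/=; apply: ler_sum => i _.
have FiE : F i = (F i `&` A) `|` (F i `&` B).
  rewrite -setIUr; apply/esym/setIidPl => x Fx.
  by rewrite -FAB; exists i.
rewrite {1}FiE vmeasureU; first by rewrite ler_normD.
- exact: measurableI.
- exact: measurableI.
- by rewrite setIACA AB setI0.
Qed.

(** [vtotal_variation] is -oo on nonmeasurable sets, which have no measurable
    partition; truncating at 0 makes it a measure in the sense of the hierarchy.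
    The integrals are the same ([integral_vtv]), as they look at measurable sets
    only. *)
Definition total_variation_measure (_ : vector_measure mu) (A : set X) : \bar R :=
  maxe 0%E (vtotal_variation mu A).

Local Notation tvm := (total_variation_measure vmu).

Lemma tvmE A : measurable A -> tvm A = tv A.
Proof. by move=> mA; apply/max_idPr; exact: vtv_ge0. Qed.

Let tvm_ge0 A : (0 <= tvm A)%E.
Proof. by rewrite /total_variation_measure le_max lexx. Qed.

Let tvm_semi_additive : measure_function.semi_additive tvm.
Proof.
apply/additive2P; first by rewrite tvmE// vtv0.
move=> A B mA mB AB; rewrite !tvmE//; last exact: measurableU.
by apply/eqP; rewrite eq_le vtvU_le// le_vtvU.
Qed.

HB.instance Definition _ := isContent.Build d X R tvm tvm_ge0 tvm_semi_additive.

Let tvm_semi_sigma_additive : semi_sigma_additive tvm.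
Proof.
move=> F mF tF mUF.
have part n : (\sum_(0 <= i < n) tvm (F i) <= tvm (\bigcup_n F n))%E.
  rewrite big_mkord -measure_semi_additive//; last exact: bigsetU_measurable.
  apply: le_measure; rewrite ?inE//; first exact: bigsetU_measurable.
  by rewrite -bigcup_mkord => x [i _ Fx]; exists i.
have cv : cvgn (fun n => \sum_(0 <= i < n) tvm (F i))%E.
  by apply: is_cvg_nneseries.
suff -> : tvm (\bigcup_n F n) = (\sum_(0 <= i <oo) tvm (F i))%E by [].
apply/eqP; rewrite eq_le; apply/andP; split; last first.
  by apply: lime_le => //; exact: nearW.
rewrite [leLHS]tvmE//; apply: ge_ereal_sup => _ [m [G [mG tG GF ->]]].
have cvG : \sum_(i < m) `|\sum_(k < n) mu (G i `&` F k)| @[n --> \oo] -->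
    \sum_(i < m) `|mu (G i)|.
  apply: cvg_big => [|i _]; first exact: add_continuous.
  have GiE : \bigcup_k (G i `&` F k) = G i.
    by rewrite -setI_bigcupr -GF; apply/setIidPl => x Gx; exists i.
  apply: cvg_norm; rewrite -[X in _ --> mu X]GiE.
  by apply: vmu; [move=> k; exact: measurableI|exact: trivIset_setIl].
have cvGE : (\sum_(i < m) `|\sum_(k < n) mu (G i `&` F k)|)%:E @[n --> \oo] -->
    (\sum_(i < m) `|mu (G i)|)%:E.
  by apply: cvg_EFin cvG; exact: nearW.
apply: (cvge_to_le cvGE); apply: nearW => n.
apply: (@le_trans _ _ (\sum_(0 <= k < n) tvm (F k))%E); last exact: nneseries_lim_ge.
rewrite big_mkord; apply: (@le_trans _ _
    (\sum_(k < n) (\sum_(i < m) `|mu (G i `&` F k)|)%:E)%E).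
  rewrite sumEFin lee_fin exchange_big/=.
  by apply: ler_sum => i _; exact: ler_norm_sum.
apply: lee_sum => k _; rewrite tvmE//; apply: vtv_partition.
- by move=> i; exact: measurableI.
- exact: trivIset_setIr.
- by rewrite -setI_bigcupl GF; apply/setIidPr => x Fx; exists k.
Qed.

HB.instance Definition _ :=
  Content_isMeasure.Build d X R tvm tvm_semi_sigma_additive.

End vector_measure.

(** * Step functions and the fundamental estimate *)

Section step_functions.
Context (R : realType) (H : completeNormedModType R).
Context (dot : {dot H for (@idfun R)}) (dotE : norm_induced_by dot).
Context d (X : measurableType d).
Context (mu : set X -> H) (vmu : vector_measure mu).
Implicit Types (A E : set X) (s : seq (set X * H)) (t : vsimple H X) (g : X -> H).

Local Notation tvm := (total_variation_measure vmu).

Import HBNNSimple.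

Lemma integral_vtv (f : X -> \bar R) :
  (\int[vtotal_variation mu]_x f x = \int[tvm]_x f x)%E.
Proof.
rewrite /integral/=.
have sintE (h : {nnsfun X >-> R}) :
    sintegral (vtotal_variation mu) h = sintegral tvm h.
  by apply: eq_fsbigr => r _; rewrite tvmE.
by congr (ereal_sup _ - ereal_sup _)%E; apply/seteqP; split => _ [k kh <-];
  exists k.
Qed.

(** Lists of pairs (set, value), the sets being allowed to overlap: unlike
    [vsimple], this representation is closed under sums by concatenation. *)
Definition step s (x : X) : H := \sum_(p <- s) (\1_(p.1) x : R) *: p.2.

Definition step_integral s : R := \sum_(p <- s) dot p.2 (mu p.1).

Definition step_measurable s := forall p, p \in s -> measurable p.1.

Lemma step_cons p s x : step (p :: s) x = (\1_(p.1) x : R) *: p.2 + step s x.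
Proof. by rewrite /step big_cons. Qed.

Lemma step_measurable_cons p s :
  step_measurable (p :: s) <-> measurable p.1 /\ step_measurable s.
Proof.
split=> [ms|[mp ms] q]; last by rewrite inE => /predU1P[->//|]; exact: ms.
by split=> [|q qs]; apply: ms; rewrite inE ?eqxx// qs orbT.
Qed.

Lemma step_cat s1 s2 x : step (s1 ++ s2) x = step s1 x + step s2 x.
Proof. by rewrite /step big_cat. Qed.

Lemma step_integral_cat s1 s2 :
  step_integral (s1 ++ s2) = step_integral s1 + step_integral s2.
Proof. by rewrite /step_integral big_cat. Qed.

Definition step_opp s := [seq (p.1, - p.2) | p <- s].

Lemma step_oppE s x : step (step_opp s) x = - step s x.
Proof.
rewrite /step big_map -sumrN.
by apply: eq_bigr => p _ /=; rewrite scalerN.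
Qed.

Lemma step_integral_opp s : step_integral (step_opp s) = - step_integral s.
Proof.
rewrite /step_integral big_map -sumrN.
by apply: eq_bigr => p _ /=; rewrite dotNl.
Qed.

Lemma step_measurableB s1 s2 : step_measurable s1 -> step_measurable s2 ->
  step_measurable (s1 ++ step_opp s2).
Proof.
move=> m1 m2 p; rewrite mem_cat => /orP[/m1//|/mapP[q qs ->]].
exact: m2 qs.
Qed.

(** The offset w is what makes the induction work: on the first set A of the list
    its value v is absorbed into w, off A it disappears. *)
Lemma step_norm_measurable w s : step_measurable s ->
  measurable_fun setT (fun x => `|w + step s x|).
Proof.
elim: s w => [w _|[A v] s ih w /step_measurable_cons[/= mA ms]].
  by under eq_fun do rewrite /step big_nil; exact: measurable_cst.
rewrite (_ : (fun x => _) = (fun x => (\1_A x : R) * `|(w + v) + step s x| +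
    (\1_(~` A) x : R) * `|w + step s x|)); last first.
  apply/funext => x; rewrite step_cons/= !indicE in_setC.
  case: (x \in A) => /=; rewrite ?mul1r ?mul0r ?addr0 ?add0r.
    by rewrite scale1r addrA.
  by rewrite scale0r add0r.
apply: measurable_funD; apply: measurable_funM; try exact: ih;
  apply: measurable_indic => //; exact: measurableC.
Qed.

(** With E the whole space and w = 0 this bounds the integral of a step function.
    Overlapping sets are dealt with by the general E and w: E is cut by the first
    set A of the list, v being added to w on the part inside A, until no set is
    left and Cauchy-Schwarz with |mu E| <= |mu|(E) concludes. *)
Lemma step_integral_le E w s : measurable E -> step_measurable s ->
  (`|dot w (mu E) + \sum_(p <- s) dot p.2 (mu (E `&` p.1))|%:E <=
   \int[tvm]_(x in E) (`|w + step s x|)%:E)%E.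
Proof.
move=> + ms; have mN w' s' E' : step_measurable s' ->
    measurable_fun E' (fun x => (`|w' + step s' x|)%:E).
  move=> ms'; apply/measurable_EFinP.
  by apply: measurable_funTS; exact: step_norm_measurable.
elim: s w E ms => [w E _ mE|[A v] s ih w E /step_measurable_cons[/= mA ms] mE].
  rewrite big_nil addr0.
  under eq_integral do rewrite /step big_nil addr0.
  rewrite integral_cst//= tvmE//.
  apply: (@le_trans _ _ (`|w|%:E * `|mu E|%:E)%E).
    by rewrite -EFinM lee_fin; exact: CauchySchwarz_dot.
  by rewrite lee_wpmul2l// vmeasure_le_vtv.
have mEA : measurable (E `&` A) by exact: measurableI.
have mEDA : measurable (E `\` A) by exact: measurableD.
rewrite -[X in integral _ X _](setUIDK E A) ge0_integral_setU//; last 2 first.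
- by apply: mN; apply/step_measurable_cons.
- by rewrite disj_set2E setDE setIACA setICr setI0.
have -> : (\int[tvm]_(x in E `&` A) (`|w + step ((A, v) :: s) x|)%:E =
    \int[tvm]_(x in E `&` A) (`|(w + v) + step s x|)%:E)%E.
  apply: eq_integral => x /set_mem[_ Ax].
  by rewrite step_cons/= indicE mem_set// scale1r addrA.
have -> : (\int[tvm]_(x in E `\` A) (`|w + step ((A, v) :: s) x|)%:E =
    \int[tvm]_(x in E `\` A) (`|w + step s x|)%:E)%E.
  apply: eq_integral => x /set_mem[_ Ax].
  by rewrite step_cons/= indicE memNset// scale0r add0r.
apply: le_trans (leeD (ih (w + v) _ ms mEA) (ih w _ ms mEDA)).
rewrite -EFinD lee_fin; apply: le_trans (ler_normD _ _).
rewrite le_eqVlt; apply/predU1P; left; congr `| _ |.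
rewrite big_cons/= dotDl [in LHS](vmeasure_setID vmu mE mA) dotDr.
have -> : \sum_(p <- s) dot p.2 (mu (E `&` p.1)) =
    \sum_(p <- s) dot p.2 (mu (E `&` A `&` p.1)) +
    \sum_(p <- s) dot p.2 (mu ((E `\` A) `&` p.1)).
  rewrite -big_split/= !big_seq; apply: eq_bigr => p /ms mp.
  rewrite -dotDr; congr (dot _ _).
  rewrite [LHS](vmeasure_setID vmu _ mA); last exact: measurableI.
  by congr (mu _ + mu _); rewrite ?setDE setIAC.
by ring.
Qed.

Lemma norm_step_integral s : step_measurable s ->
  (`|step_integral s|%:E <= \int[tvm]_x (`|step s x|)%:E)%E.
Proof.
move=> ms; have := step_integral_le 0 measurableT ms.
rewrite dot0l add0r; under eq_bigr do rewrite setTI.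
by under eq_integral do rewrite add0r.
Qed.

Definition step_of t : seq (set X * H) :=
  [seq (vs_set j, vs_val j) | j <- index_enum 'I_(vs_size t)].

Lemma step_ofE t x : step (step_of t) x = vsimple_fun t x.
Proof. by rewrite /step big_map. Qed.

Lemma step_integral_ofE t :
  step_integral (step_of t) = vsimple_integral dot mu t.
Proof. by rewrite /step_integral big_map. Qed.

Lemma step_of_measurable t : step_measurable (step_of t).
Proof. by move=> p /mapP[j _ ->]; exact: vs_measurable. Qed.

(** H carries no sigma-algebra here, so measurability is obtained for the norm
    only, as a pointwise limit of norms of step functions. *)
Lemma strongly_measurable_dist g s : strongly_measurable setT g ->
  step_measurable s -> measurable_fun setT (fun x => (`|step s x - g x|)%:E).
Proof.
move=> [t tg] ms; apply/measurable_EFinP.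
apply: (measurable_fun_cvg
  (h := fun n x => `|0 + step (s ++ step_opp (step_of (t n))) x|)).
  move=> n; apply: step_norm_measurable.
  exact: step_measurableB (@step_of_measurable _).
move=> x _; apply: cvg_norm.
under eq_fun do rewrite add0r step_cat step_oppE step_ofE.
by apply: cvgB; [exact: cvg_cst|exact: tg].
Qed.

Lemma strongly_measurable_norm g : strongly_measurable setT g ->
  measurable_fun setT (fun x => (`|g x|)%:E).
Proof.
move=> /(@strongly_measurable_dist _ [::])/(_ _)-/(_ ltac:(by [])).
by under eq_fun do rewrite /step big_nil sub0r normrN.
Qed.

(** This is what makes the integrals along an L^1 approximation of g Cauchy, and
    those along two approximations equivalent. *)
Lemma step_integral_dist g s1 s2 : strongly_measurable setT g ->
  step_measurable s1 -> step_measurable s2 ->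
  (`|step_integral s1 - step_integral s2|%:E <=
    \int[tvm]_x (`|step s1 x - g x|)%:E + \int[tvm]_x (`|step s2 x - g x|)%:E)%E.
Proof.
move=> mg m1 m2; have m12 := step_measurableB m1 m2.
rewrite -step_integral_opp -step_integral_cat.
apply: (le_trans (norm_step_integral m12)).
rewrite -ge0_integralD//; [|exact: strongly_measurable_dist..].
apply: ge0_le_integral => //.
- by apply/measurable_EFinP; have := step_norm_measurable 0 m12;
    under eq_fun do rewrite add0r.
- by apply: emeasurable_funD; exact: strongly_measurable_dist.
move=> x _; rewrite -EFinD lee_fin step_cat step_oppE.
rewrite -[X in `|X|](subrKA (g x)) -(opprB (step s2 x)).
by rewrite (le_trans (ler_normD _ _))// normrN.
Qed.

End step_functions.

(** * Calculus of the vector integral *)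

Section is_vintegral.
Context (R : realType) (H : completeNormedModType R).
Context (dot : {dot H for (@idfun R)}) (dotE : norm_induced_by dot).
Context d (X : measurableType d).
Context (mu : set X -> H) (vmu : vector_measure mu).
Implicit Types (A : set X) (g : X -> H).

Local Notation tvm := (total_variation_measure vmu).

Definition L1_approx (t : nat -> vsimple H X) g :=
  (\int[vtotal_variation mu]_x (`|vsimple_fun (t n) x - g x|)%:E
       @[n --> \oo] --> 0)%E.

(** The property selected by [vintegral]. *)
Definition is_vintegral g (I : R) := vL1 mu g /\
  exists t : nat -> vsimple H X, L1_approx t g /\
    vsimple_integral dot mu (t n) @[n --> \oo] --> I.

Lemma L1_approxP (t : nat -> vsimple H X) g : L1_approx t g ->
  forall e : R, 0 < e ->
  \forall n \near \oo, (\int[tvm]_x (`|step (step_of (t n)) x - g x|)%:E < e%:E)%E.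
Proof.
move=> tg e e0; have : nbhs (0%:E : \bar R) [set x : \bar R | x < e%:E]%E.
  by apply: open_nbhs_nbhs; split; [exact: open_ereal_lt_ereal|rewrite /= lte_fin].
move=> /tg[N _ tN]; exists N => // n /tN /=; rewrite integral_vtv.
by under eq_integral do rewrite -step_ofE.
Qed.

Lemma L1_approx_cauchy (t : nat -> vsimple H X) g :
  strongly_measurable setT g -> L1_approx t g ->
  cvgn (fun n => vsimple_integral dot mu (t n)).
Proof.
move=> mg tg; apply/cauchy_cvgP/cauchy_exP => e e0.
have e2 : 0 < e / 2 by rewrite divr_gt0.
have [N _ tN] := L1_approxP tg e2.
exists (vsimple_integral dot mu (t N)); exists N => // n /= Nn.
rewrite -ball_normE/= -!step_integral_ofE -lte_fin.
apply: (le_lt_trans (step_integral_dist dotE vmu mg _ _)).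
- exact: step_of_measurable.
- exact: step_of_measurable.
by rewrite (splitr e) EFinD; apply: lteD; apply: tN => /=.
Qed.

Lemma vintegral_bound g I : is_vintegral g I ->
  (`|I|%:E <= \int[tvm]_x (`|g x|)%:E)%E.
Proof.
move=> [[mg _] [t [tg tI]]]; apply/lee_addgt0Pr => e e0.
have cvI : `|vsimple_integral dot mu (t n)|%:E @[n --> \oo] --> `|I|%:E.
  by apply: cvg_EFin; [exact: nearW|exact: cvg_norm].
apply: (cvge_to_le cvI); apply: filterS (L1_approxP tg e0) => n tn.
rewrite -step_integral_ofE -[step_integral _ _ _]subr0.
have := @step_integral_dist _ _ _ dotE _ _ _ vmu g (step_of (t n)) [::] mg
  (@step_of_measurable _ _ _ _ _) ltac:(by []).
rewrite [X in _ - X]/step_integral big_nil.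
under [X in (_ <= _ + X)%E]eq_integral do rewrite /step big_nil sub0r normrN.
by move=> /le_trans; apply; rewrite addeC leeD2l// ltW.
Qed.

Lemma is_vintegral_unique g I J : is_vintegral g I -> is_vintegral g J -> I = J.
Proof.
move=> [[mg _] [t [tg tI]]] [_ [t' [tg' tJ]]].
apply/eqP; rewrite -subr_eq0 -normr_le0; apply/ler_addgt0Pr => e e0; rewrite add0r.
have e2 : 0 < e / 2 by rewrite divr_gt0.
apply: (@cvgr_to_le _ \oo _ _ _ _ _ (cvg_norm (cvgB tI tJ))).
apply: filterS2 (L1_approxP tg e2) (L1_approxP tg' e2) => n tn t'n.
apply/ltW; rewrite /= !fctE -!step_integral_ofE -lte_fin.
apply: (le_lt_trans (step_integral_dist dotE vmu mg _ _)).
- exact: step_of_measurable.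
- exact: step_of_measurable.
by rewrite (splitr e) EFinD; exact: lteD.
Qed.

Lemma vintegralP g I : is_vintegral g I -> vintegral dot mu g = I.
Proof.
move=> gI; apply: xget_subset1 => // J K; exact: is_vintegral_unique.
Qed.

(** The dummy value 0 being harmless in an inequality, a function without
    integral never has to be excluded. *)
Lemma vintegral_case g (P : R -> Prop) : P 0 ->
  (forall I, is_vintegral g I -> P I) -> P (vintegral dot mu g).
Proof. by move=> P0 PI; rewrite /vintegral; case: xgetP => // I _ gI; exact: PI. Qed.

Program Definition vsimple_restr (t : vsimple H X) A (mA : measurable A) : vsimple H X :=
  @VSimple R H d X (vs_size t) (fun j => vs_set j `&` A) (@vs_val _ _ _ _ t) _ _.
Next Obligation. by move=> t A mA j; apply: measurableI => //; exact: vs_measurable. Qed.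
Next Obligation. by move=> t A mA; apply: trivIset_setIr; exact: vs_disjoint. Qed.

Lemma vsimple_restrE (t : vsimple H X) A (mA : measurable A) x :
  vsimple_fun (vsimple_restr t mA) x = (\1_A x : R) *: vsimple_fun t x.
Proof.
rewrite /vsimple_fun scaler_sumr; apply: eq_bigr => j _ /=.
by rewrite scalerA !indicE in_setI mulrC -natrM mulnb.
Qed.

Lemma strongly_measurable_restr g A : measurable A -> strongly_measurable setT g ->
  strongly_measurable setT (fun x => (\1_A x : R) *: g x).
Proof.
move=> mA [t tg]; exists (fun n => vsimple_restr (t n) mA) => x _.
under eq_fun do rewrite vsimple_restrE.
by apply: cvgZ; [exact: cvg_cst|exact: tg].
Qed.

Lemma vL1_restr g A : measurable A -> vL1 mu g ->
  vL1 mu (fun x => (\1_A x : R) *: g x).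
Proof.
move=> mA [mg ig]; split; first exact: strongly_measurable_restr.
apply: le_lt_trans ig; rewrite !integral_vtv; apply: ge0_le_integral => //.
- by apply: strongly_measurable_norm; exact: strongly_measurable_restr.
- exact: strongly_measurable_norm.
move=> x _; rewrite lee_fin normrZ indicE.
by case: (x \in A); rewrite ?normr1 ?mul1r// normr0 mul0r.
Qed.

Lemma L1_approx_restr (t : nat -> vsimple H X) g A (mA : measurable A) :
  strongly_measurable setT g ->
  L1_approx t g ->
  L1_approx (fun n => vsimple_restr (t n) mA) (fun x => (\1_A x : R) *: g x).
Proof.
move=> mg; apply: squeeze_cvge; last exact: cvg_cst.
  apply: nearW => n; rewrite !integral_vtv integral_ge0//=.
  under eq_integral do rewrite -step_ofE.
  under [leRHS]eq_integral do rewrite -step_ofE.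
  apply: ge0_le_integral => //.
  - apply: strongly_measurable_dist; last exact: step_of_measurable.
    exact: strongly_measurable_restr.
  - by apply: strongly_measurable_dist => //; exact: step_of_measurable.
  move=> x _; rewrite lee_fin !step_ofE vsimple_restrE -scalerBr normrZ indicE.
  by case: (x \in A); rewrite ?normr1 ?mul1r// normr0 mul0r.
Qed.

(** Restricting an approximating sequence to A and to its complement gives
    approximations of both pieces, so that both integrals exist. *)
Lemma vintegral_split g I A : is_vintegral g I -> measurable A ->
  exists J K, [/\ is_vintegral (fun x => (\1_A x : R) *: g x) J,
    is_vintegral (fun x => (\1_(~` A) x : R) *: g x) K & I = J + K].
Proof.
move=> [Lg [t [tg tI]]] mA; have mC := measurableC mA.
have mg := Lg.1.
have tA := L1_approx_restr mA mg tg; have tC := L1_approx_restr mC mg tg.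
have cvA := L1_approx_cauchy (strongly_measurable_restr mA mg) tA.
have cvC := L1_approx_cauchy (strongly_measurable_restr mC mg) tC.
exists (limn (fun n => vsimple_integral dot mu (vsimple_restr (t n) mA))).
exists (limn (fun n => vsimple_integral dot mu (vsimple_restr (t n) mC))).
split.
- by split; [exact: vL1_restr|exists (fun n => vsimple_restr (t n) mA)].
- by split; [exact: vL1_restr|exists (fun n => vsimple_restr (t n) mC)].
apply: norm_cvg_unique tI _.
rewrite (_ : (fun n => _) = (fun n => vsimple_integral dot mu (vsimple_restr (t n) mA)
   + vsimple_integral dot mu (vsimple_restr (t n) mC))); first exact: cvgD.
apply/funext => n; rewrite /vsimple_integral -big_split/=.
apply: eq_bigr => j _; rewrite -dotDr; congr (dot _ _).
by rewrite [LHS](vmeasure_setID vmu (vs_measurable j) mA) setDE.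
Qed.

Lemma vintegral_point g K x : measurable [set x] ->
  is_vintegral (fun y => (\1_[set x] y : R) *: g y) K -> K = dot (g x) (mu [set x]).
Proof.
move=> mx gK; apply: (is_vintegral_unique gK); split; first exact: gK.1.
have tx : trivIset setT (fun _ : 'I_1 => [set x]) by move=> i j _ _ _; rewrite !ord1.
pose t := @VSimple R H d X 1 (fun=> [set x]) (fun=> g x) (fun=> mx) tx.
exists (fun=> t); split; last first.
  by rewrite /vsimple_integral/= big_ord1; exact: cvg_cst.
rewrite /L1_approx integral_vtv.
rewrite (eq_integral (cst 0%E)) ?integral0; first exact: cvg_cst.
move=> y _; rewrite /vsimple_fun/= big_ord1 indicE in_set1.
case: (eqVneq y x) => [->|_]; first by rewrite subrr normr0.
by rewrite !scale0r subrr normr0.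
Qed.

Lemma vintegral_finite_le0 g (s : seq X) K : (forall x : X, measurable [set x]) ->
  (forall x, x \in s -> dot (g x) (mu [set x]) <= 0) ->
  is_vintegral (fun y => (\1_[set` s] y : R) *: g y) K -> K <= 0.
Proof.
move=> mx; elim: s g K => [g K _ gK|x s ih g K gs gK].
  rewrite (le_trans (ler_norm _))// -lee_fin.
  apply: (le_trans (vintegral_bound gK)).
  rewrite (eq_integral (cst 0%E)) ?integral0// => y _.
  by rewrite set_nil indic0/= scale0r normr0.
have [J [K' [hJ hK' ->]]] := vintegral_split gK (mx x).
rewrite (vintegral_point (mx x) hJ) indicE mem_set/= ?mem_head// scale1r.
rewrite -[leRHS]addr0 lerD ?gs ?mem_head//.
apply: (ih (fun y => (\1_(~` [set x]) y : R) *: g y)).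
  move=> y ys; rewrite dotZl mulr_ge0_le0 ?indicE//.
  by rewrite gs// inE ys orbT.
rewrite (_ : (fun y => _) = (fun y => (\1_(~` [set x]) y : R) *:
   ((\1_[set` x :: s] y : R) *: g y)))//.
apply/funext => y; rewrite !scalerA; congr (_ *: _).
rewrite !indicE in_setC in_set1 [RHS]mulrC !mem_setE inE.
by case: eqVneq => //= _; rewrite !mulr0.
Qed.

(** Finite subsets of D contribute nonpositive amounts, and the integral of |g|
    over the rest of D tends to 0. *)
Lemma vintegral_countable_le0 g (D : set X) K : (forall x : X, measurable [set x]) ->
  countable D -> (forall x, D x -> dot (g x) (mu [set x]) <= 0) ->
  is_vintegral (fun y => (\1_D y : R) *: g y) K -> K <= 0.
Proof.
move=> mx cD gD gK; set h := fun y => (\1_D y : R) *: g y in gK.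
have /countable_injP[f fI] := cD.
pose Dn n := D `&` f @^-1` `I_n.
have fin n : finite_set (Dn n).
  have /inj_card_eq/eq_finite_set <- : {in Dn n &, injective f}.
    by move=> x y /set_mem[xD _] /set_mem[yD _]; apply: fI; exact: mem_set.
  by apply: sub_finite_set (finite_II n) => _ [x [_ fx] <-].
have mDn n : measurable (Dn n).
  by apply: (countable_measurable mx); apply: finite_set_countable; exact: fin.
have [[mh ih] _] := gK.
have hn n : strongly_measurable setT (fun x => (\1_(~` Dn n) x : R) *: h x).
  by apply: strongly_measurable_restr => //; exact: measurableC.
have cv : (\int[tvm]_x (`|(\1_(~` Dn n) x : R) *: h x|)%:E @[n --> \oo] --> 0)%E.
  have := @dominated_convergence _ _ _ tvm setT measurableT
    (fun n x => (`|(\1_(~` Dn n) x : R) *: h x|)%:E) (cst 0%E)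
    (fun x => (`|h x|)%:E).
  case=> //.
  - by move=> n; exact: strongly_measurable_norm.
  - apply: aeW => x _; apply: cvg_near_cst.
    have [Dx|Dx] := pselect (D x).
      exists (f x).+1 => // n /= fn; rewrite indicE memNset ?scale0r ?normr0//.
      by move=> nD; apply: nD; split.
    by apply: nearW => n; rewrite /h [\1_D x]indicE memNset// scale0r scaler0 normr0.
  - apply/integrableP; split; first exact: strongly_measurable_norm.
    by under eq_integral do rewrite abse_EFin normr_id; rewrite -integral_vtv.
  - apply: aeW => x n _; rewrite abse_EFin normr_id lee_fin normrZ indicE.
    by case: (x \in _); rewrite ?normr1 ?mul1r// normr0 mul0r.
  by move=> _ _; rewrite integral0.
apply/ler_addgt0Pr => e e0; rewrite add0r.
have [n ne] : exists n, (\int[tvm]_x (`|(\1_(~` Dn n) x : R) *: h x|)%:E < e%:E)%E.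
  have : nbhs (0%:E : \bar R) [set x : \bar R | x < e%:E]%E.
    by apply: open_nbhs_nbhs; split; [exact: open_ereal_lt_ereal|rewrite /= lte_fin].
  by move=> /cv[N _ /(_ N (leqnn N))]; exists N.
have [J [K' [hJ hK' ->]]] := vintegral_split gK (mDn n).
have K'e : K' <= e.
  rewrite (le_trans (ler_norm _))// -lee_fin.
  by apply: (le_trans (vintegral_bound hK')); exact: ltW.
rewrite -[e]add0r lerD//.
have /finite_seqP[s sD] := fin n.
apply: (@vintegral_finite_le0 g s) => //.
  by move=> x xs; apply: gD; have [] : Dn n x by rewrite sD.
rewrite -sD (_ : (fun y => _) = (fun y => (\1_(Dn n) y : R) *: h y))//.
apply/funext => y; rewrite /h scalerA !indicE -natrM mulnb -in_setI.
by rewrite /Dn setIAC setIid.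
Qed.

End is_vintegral.

(** * Functions of bounded variation *)

Lemma countable_setU (T : Type) (A B : set T) :
  countable A -> countable B -> countable (A `|` B).
Proof.
move=> cA cB; have -> : A `|` B = \bigcup_(b in [set: bool]) if b then A else B.
  by apply/seteqP; split=> [x [?|?]|x [[] _ ?]];
    by [exists true|exists false|left|right].
by apply: bigcup_countable => // -[].
Qed.

Section bounded_variation.
Context (R : realType) (H : completeNormedModType R).
Implicit Types (f : R -> H) (T s t : R).

(** A subdivision of [a, s] is continued to t, passing through s if it stops
    before. *)
Lemma pointwise_variation_extend f a s t : a <= s -> s < t ->
  (pointwise_variation f a s + `|f t - f s|%:E <= pointwise_variation f a t)%E.
Proof.
move=> as_ st; rewrite -leeBrDr//; apply: ge_ereal_sup => _ [m [p [m0 pS pin ->]]].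
rewrite leeBrDr// -EFinD.
have pm := pin m (leqnn m); rewrite in_itv/= in pm; have /andP[ap ps] := pm.
have widen j : (j <= m)%N -> p j \in `[a, t].
  move=> /pin; rewrite !in_itv/= => /andP[-> pjs].
  by rewrite (le_trans pjs)// ltW.
have tin : t \in `[a, t] by rewrite in_itv/= lexx (le_trans as_)// ltW.
have sin : s \in `[a, t] by rewrite in_itv/= as_ ltW.
have [pms|pms] := eqVneq (p m) s.
- pose q j := if (j <= m)%N then p j else t.
  apply: ereal_sup_ubound; exists m.+1, q; split => //.
  + move=> j jm1; rewrite /q; have [jm|mj|->] := ltngtP j m.
    * exact: pS.
    * by rewrite ltnNge -ltnS jm1 in mj.
    * by rewrite pms.
  + by move=> j _; rewrite /q; case: ifPn => // /widen.
  rewrite big_ord_recr/= /q ltnn leqnn pms; congr (_ + _)%:E.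
  by apply: eq_bigr => j _; rewrite ltn_ord (ltnW (ltn_ord j)).
- have pms' : p m < s by rewrite lt_neqAle pms.
  pose q j := if (j <= m)%N then p j else if j == m.+1 then s else t.
  apply: (@le_trans _ _ ((\sum_(j < m.+2) `|f (q j.+1) - f (q j)|)%:E)).
    have qp : \sum_(j < m) `|f (q j.+1) - f (q j)| =
        \sum_(j < m) `|f (p j.+1) - f (p j)|.
      by apply: eq_bigr => j _; rewrite /q ltn_ord (ltnW (ltn_ord j)).
    rewrite lee_fin 2!big_ord_recr/= qp /q ltnn eqxx.
    by rewrite ltnNge leqnSn/= leqnn (gtn_eqF (ltnSn m.+1)) lerD2r lerDl.
  apply: ereal_sup_ubound; exists m.+2, q; split => //.
  + move=> j jm2; rewrite /q; have [jm|mj|->] := ltngtP j m.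
    * exact: pS.
    * have -> : j = m.+1 by apply/eqP; rewrite eqn_leq mj andbT.
      by rewrite eqxx (gtn_eqF (ltnSn m.+1)).
    * by rewrite eqxx.
  + by move=> j _; rewrite /q; case: ifPn => [/widen//|_]; case: ifPn.
Qed.

(** The variation on [0, s] as a function of s: a bounded monotone real function
    whose increments dominate those of f.  It transfers the existence of one-sided
    limits to the vector-valued f.  The point s = 0 is left out because [0, 0]
    has no subdivision, which makes the variation there -oo. *)
Lemma BV_dominated T f : BV T f -> exists v : R -> R,
  (forall s, 0 < s -> s <= T -> 0 <= v s) /\
  (forall s t, 0 < s -> s <= t -> t <= T -> `|f t - f s| <= v t - v s).
Proof.
move=> bv; exists (fun s => fine (pointwise_variation f 0 s)).
have ge0 s : 0 < s -> (0 <= pointwise_variation f 0 s)%E.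
  move=> s0; apply: (@le_trans _ _ (`|f s - f 0|)%:E); first by rewrite lee_fin.
  apply: ereal_sup_ubound; exists 1, (fun j => if j == 0 then 0 else s); split => //.
  - by move=> [|].
  - by move=> [|[|]]//= _; rewrite in_itv/= ?lexx ?ltW.
  by rewrite big_ord1.
have le s t : 0 < s -> s <= t ->
    (pointwise_variation f 0 s + `|f t - f s|%:E <= pointwise_variation f 0 t)%E.
  move=> s0; rewrite le_eqVlt => /predU1P[->|st].
    by rewrite subrr normr0 adde0.
  by apply: pointwise_variation_extend => //; exact: ltW.
have fin s : 0 < s -> s <= T -> pointwise_variation f 0 s \is a fin_num.
  move=> s0 sT; rewrite ge0_fin_numE ?ge0//; apply: le_lt_trans bv.
  by apply: le_trans (le s T s0 sT); rewrite leeDl.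
split=> [s s0 sT|s t s0 st tT]; first by rewrite fine_ge0 ?ge0.
have t0 := lt_le_trans s0 st.
rewrite lerBrDl -lee_fin EFinD !fineK ?fin//; first exact: le.
exact: le_trans tT.
Qed.

Lemma BV_right_cvg T f t : BV T f -> 0 <= t -> t < T -> cvg (f x @[x --> t^'+]).
Proof.
move=> /BV_dominated[v [v0 fv]] t0 tT.
pose E := [set v s | s in [set s | t < s <= T]].
have Einf : has_inf E.
  split; first by exists (v T), T => //=; rewrite tT lexx.
  by exists 0 => _ [s /andP[ts sT] <-]; apply: v0 => //; exact: le_lt_trans ts.
apply/cauchy_cvgP/cauchy_exP => e e0.
have [_ [s /andP[ts sT] <-] vs] := inf_adherent e0 Einf.
exists (f s); apply: filterS2 (nbhs_right_gt t) (nbhs_right_lt ts) => r tr rs.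
rewrite -ball_normE/=.
have vr : inf E <= v r.
  apply: ge_inf; first exact: (proj2 Einf).
  by exists r => //=; rewrite tr (le_trans (ltW rs)).
have := fv r s (le_lt_trans t0 tr) (ltW rs) sT.
by move=> /le_lt_trans; apply; rewrite ltrBlDr (lt_le_trans vs)// addrC lerD2l.
Qed.

Lemma BV_left_cvg T f t : BV T f -> 0 < t -> t <= T -> cvg (f x @[x --> t^'-]).
Proof.
move=> /BV_dominated[v [v0 fv]] t0 tT.
pose E := [set v s | s in [set s | 0 < s < t]].
have Esup : has_sup E.
  split; first by exists (v (t / 2)), (t / 2) => //=; lra.
  exists (v T) => _ [s /andP[s0 st] <-].
  have sT := le_trans (ltW st) tT.
  by rewrite -subr_ge0; apply: le_trans (fv s T s0 sT (lexx T)).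
apply/cauchy_cvgP/cauchy_exP => e e0.
have [_ [s /andP[s0 st] <-] vs] := sup_adherent e0 Esup.
exists (f s); apply: filterS2 (nbhs_left_lt t) (nbhs_left_gt st) => r rt sr.
rewrite -ball_normE/= distrC.
have vr : v r <= sup E.
  by apply: ub_le_sup (proj2 Esup) _ _; exists r => //=; rewrite rt (lt_trans s0).
have := fv s r s0 (ltW sr) (le_trans (ltW rt) tT).
move=> /le_lt_trans; apply; rewrite ltrBlDr -ltrBlDl.
by apply: le_lt_trans vs; rewrite lerD2r.
Qed.

(** Where the oscillation of f at t is at least 1/(n+1), the right limit at t
    forces the oscillation to be smaller on some interval ]t, t + r[.  For a fixed
    n these intervals are pairwise disjoint and nonempty, hence countably many. *)
Lemma Discont_countable T f :
  (forall t, 0 <= t -> t < T -> cvg (f x @[x --> t^'+])) -> countable (Discont T f).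
Proof.
move=> fr.
pose osc n s := \forall r \near within `[0, T] (nbhs s), `|f s - f r| < n.+1%:R^-1.
pose D n := [set s | [/\ 0 <= s, s < T & ~ osc n s]].
have DE : Discont T f `<=` [set T] `|` \bigcup_n D n.
  move=> t [/= tT ct]; move: (tT).
  rewrite in_itv/= [X in _ && X]le_eqVlt => /andP[t0 /predU1P[->|ltT]].
    by left.
  right; apply: contrapT => nD; apply: ct; split=> //.
  apply/cvgrPdist_lt => e e0.
  have [n ne] := ltr_add_invr e0; rewrite add0r in ne.
  have : osc n t by apply: contrapT => no; apply: nD; exists n.
  by apply: filterS => r /lt_trans; exact.
apply: sub_countable (subset_card_le DE) _.
apply: countable_setU; first exact: countable1.
apply: bigcup_countable => // n _.
have iso t : exists r : R, 0 < r /\ (D n t -> forall s, t < s < t + r -> ~ D n s).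
  have [Dt|] := pselect (D n t); last by exists 1.
  have [t0 tT _] := Dt.
  have /cvg_ex[l /cvgrPdist_lt fl] := fr t t0 tT.
  have e0 : 0 < n.+1%:R^-1 / 2 :> R by rewrite divr_gt0// invr_gt0.
  have [r /= r0 rl] := fl _ e0.
  exists r; split=> // _ s /andP[ts sr] [_ _]; apply.
  have close x : t < x < t + r -> `|l - f x| < n.+1%:R^-1 / 2.
    move=> /andP[tx xr]; apply: rl => //=.
    by rewrite ltr0_norm ?subr_lt0// opprB ltrBlDl.
  apply: cvg_within.
  have : \forall x \near s, x \in `]t, (t + r)[
    by apply: near_in_itvoo; rewrite in_itv/= ts.
  apply: filterS => x; rewrite in_itv/= => /close fx.
  rewrite -(subrKA l) (splitr n.+1%:R^-1) (le_lt_trans (ler_normD _ _))//.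
  by rewrite ltrD// distrC close// ts.
have [r rP] := choice iso.
apply: (@separated_open_countable R R (fun t => `]t, (t + r t)[%classic)).
- by move=> t; exact: interval_open.
- move=> t; exists (t + r t / 2); rewrite /= in_itv/=.
  by have := (rP t).1 => ?; lra.
move=> t s Dt Ds [x [/=]]; rewrite !in_itv/= => /andP[tx xt] /andP[sx xs].
have [ts|st|//] := ltgtP t s.
- by case: ((rP t).2 Dt s _ Ds); rewrite ts (lt_trans sx).
- by case: ((rP s).2 Ds t _ Dt); rewrite st (lt_trans tx).
Qed.

Lemma itv_not_countable (a b : R) (D : set R) : a < b -> countable D ->
  exists t, a < t < b /\ ~ D t.
Proof.
move=> ab cD; apply: contrapT => /forallNP h.
have sub : `]a, b[ `<=` D.
  move=> t; rewrite /= in_itv/= => tab.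
  by apply: contrapT => nD; exact: (h t).
have : lebesgue_measure (`]a, b[ : set R) = 0%E.
  by apply: countable_lebesgue_measure0; exact: sub_countable (subset_card_le sub) cD.
rewrite lebesgue_measure_itv/= lte_fin ab -EFinB => -[] /eqP.
by rewrite subr_eq0 gt_eqF.
Qed.

End bounded_variation.

(** * Changing a function at one point *)

Definition update (X : eqType) (Y : Type) (a : X) (v : Y) (g : X -> Y) (x : X) :=
  if x == a then v else g x.

Section strongly_measurable_update.
Context (R : realType) (H : completeNormedModType R).
Context d (X : measurableType d).
Context (t0 : X) (mt0 : measurable [set t0]) (c : H).

Section vsimple_update.
Variable (s : vsimple H X).

Definition vsimple_update_set (j : 'I_(vs_size s).+1) : set X :=
  if unlift ord0 j is Some i then vs_set i `\ t0 else [set t0].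

Definition vsimple_update_val (j : 'I_(vs_size s).+1) : H :=
  if unlift ord0 j is Some i then vs_val i else c.

Lemma vsimple_update_measurable j : measurable (vsimple_update_set j).
Proof.
rewrite /vsimple_update_set; case: unliftP => [i _|//].
by apply: measurableD => //; exact: vs_measurable.
Qed.

Lemma vsimple_update_disjoint : trivIset setT vsimple_update_set.
Proof.
move=> i j _ _; rewrite /vsimple_update_set.
case: unliftP => [i' ->|->]; case: unliftP => [j' ->|->] => //.
- move=> [x [[xi _] [xj _]]]; congr lift.
  have tS : trivIset setT (vs_set (v := s)) by exact: vs_disjoint.
  by apply: tS => //; exists x.
- by move=> [x [[_ xt] xt']].
- by move=> [x [xt' [_ xt]]].
Qed.

Definition vsimple_update :=
  VSimple vsimple_update_val vsimple_update_measurable vsimple_update_disjoint.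

Lemma vsimple_updateE x :
  vsimple_fun vsimple_update x = update t0 c (vsimple_fun s) x.
Proof.
rewrite /vsimple_fun/= big_ord_recl /vsimple_update_set /vsimple_update_val.
rewrite unlift_none indicE in_set1 /update; case: eqVneq => [->|xt].
  rewrite scale1r big1 ?addr0// => i _.
  by rewrite liftK indicE memNset ?scale0r// => -[_ /(_ erefl)].
rewrite scale0r add0r; apply: eq_bigr => i _; rewrite liftK !indicE.
by rewrite in_setD in_set1 (negbTE xt) andbT.
Qed.

End vsimple_update.

Lemma strongly_measurable_update A (g : X -> H) : strongly_measurable A g ->
  strongly_measurable A (update t0 c g).
Proof.
move=> [s sg]; exists (fun n => vsimple_update (s n)) => x Ax.
under eq_fun do rewrite vsimple_updateE.
by rewrite /update; case: eqVneq => _; [exact: cvg_cst|exact: sg].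
Qed.

End strongly_measurable_update.

Section one_sided_limits.
Context (R : realType) (H : completeNormedModType R).
Implicit Types (f g : R -> H) (T t : R).

Lemma Cont_left_cvg T f t : Cont T f t -> 0 < t -> f x @[x --> t^'-] --> f t.
Proof.
move=> [+ ft] t0; rewrite in_itv/= => /andP[_ tT].
apply: cvg_trans ft => A; rewrite /= => wA.
have := nbhs_left_gt t0; have := nbhs_left_lt t.
have : \forall x \near t^'-, x \in `[0, T] -> A (f x) by exact: cvg_within.
by apply: filterS3 => x /= + xt x0; apply; rewrite in_itv/= !ltW// (lt_le_trans xt).
Qed.

Lemma Cont_right_cvg T f t : Cont T f t -> t < T -> f x @[x --> t^'+] --> f t.
Proof.
move=> [+ ft] tT; rewrite in_itv/= => /andP[t0 _].
apply: cvg_trans ft => A; rewrite /= => wA.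
have := nbhs_right_gt t; have := nbhs_right_lt tT.
have : \forall x \near t^'+, x \in `[0, T] -> A (f x) by exact: cvg_within.
by apply: filterS3 => x /= + xT tx; apply; rewrite in_itv/= !ltW// (le_lt_trans t0).
Qed.

Lemma Cont_left_lim T f t : Cont T f t -> left_lim f t = f t.
Proof.
move=> ft; rewrite /left_lim; case: eqVneq => // t0.
apply: cvg_lim; first exact: norm_hausdorff.
apply: Cont_left_cvg (ft) _; move: ft => [+ _].
by rewrite in_itv/= lt0r t0 => /andP[].
Qed.

Lemma Cont_right_lim T f t : Cont T f t -> right_lim T f t = f t.
Proof.
move=> ft; rewrite /right_lim; case: eqVneq => // tT.
apply: cvg_lim; first exact: norm_hausdorff.
apply: Cont_right_cvg (ft) _; move: ft => [+ _].
by rewrite in_itv/= lt_neqAle tT => /andP[].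
Qed.

Lemma eq_near_lim (F : set_system R) f g : Filter F ->
  (\forall x \near F, f x = g x) -> lim (f @ F) = lim (g @ F).
Proof.
move=> FF fg; congr (lim _); rewrite eqEsubset; split; apply: near_eq_cvg.
  by apply: filterS fg.
by apply: filterS fg.
Qed.

(** The point 0 is excluded since [left_lim] is there the value itself. *)
Lemma left_lim_update f a v t : a != 0 ->
  left_lim (update a v f) t = left_lim f t.
Proof.
move=> a0; rewrite /left_lim; case: eqVneq => [->|_].
  by rewrite /update eq_sym (negbTE a0).
apply: eq_near_lim; have [at_|ta] := ltP a t.
  by apply: filterS (nbhs_left_gt at_) => x ax; rewrite /update gt_eqF.
apply: filterS (nbhs_left_lt t) => x xt; rewrite /update lt_eqF//.
exact: lt_le_trans ta.
Qed.

Lemma right_lim_update T f a v t : a != T ->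
  right_lim T (update a v f) t = right_lim T f t.
Proof.
move=> aT; rewrite /right_lim; case: eqVneq => [->|_].
  by rewrite /update eq_sym (negbTE aT).
apply: eq_near_lim; have [ta|at_] := ltP t a.
  by apply: filterS (nbhs_right_lt ta) => x xa; rewrite /update lt_eqF.
apply: filterS (nbhs_right_gt t) => x tx; rewrite /update gt_eqF//.
exact: le_lt_trans tx.
Qed.

(** In a strictly increasing subdivision the point a occurs at most once, so it
    is an endpoint of at most two steps. *)
Lemma BV_update T f a v : BV T f -> BV T (update a v f).
Proof.
rewrite /BV => bv; set c := `|v - f a|.
suff le : (pointwise_variation (update a v f) 0 T <=
    pointwise_variation f 0 T + (c + c)%:E)%E.
  by apply: le_lt_trans le _; rewrite lte_add_pinfty// ltry.
apply: ge_ereal_sup => _ [m [p [m0 pS pin ->]]].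
pose dif x : R := if x == a then c else 0.
have c0 : 0 <= c by exact: normr_ge0.
have dif0 x : 0 <= dif x by rewrite /dif; case: ifP.
have difE x : `|update a v f x - f x| = dif x.
  by rewrite /update /dif; case: eqVneq => [->|_]//; rewrite subrr normr0.
(* The sum is 0 until the subdivision reaches a, and has one nonzero term at most. *)
have dif_sum k : (k <= m)%N -> \sum_(j < k.+1) dif (p j) <= if a <= p k then c else 0.
  elim: k => [_|k ih km]; rewrite big_ord_recr/=.
    rewrite big_ord0 add0r /dif; case: eqVneq => [->|_]; first by rewrite lexx.
    by case: ifP.
  have := ih (ltnW km); have := pS k km.
  have [apk pk /[dup] h|pka _] := leP a (p k).
    rewrite /dif gt_eqF ?(le_lt_trans apk)// addr0 ifT// ltW//.
    exact: le_lt_trans pk.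
  move=> h; apply: (@le_trans _ _ (dif (p k.+1))); first by rewrite gerDr.
  by rewrite /dif; case: eqVneq => [->|_]; [rewrite lexx|case: ifP].
have sum_c : \sum_(j < m.+1) dif (p j) <= c.
  by apply: (le_trans (dif_sum m (leqnn m))); case: ifP.
apply: (@le_trans _ _ ((\sum_(j < m) `|f (p j.+1) - f (p j)|)%:E + (c + c)%:E)%E).
  rewrite -EFinD lee_fin.
  apply: (@le_trans _ _ (\sum_(j < m) (`|f (p j.+1) - f (p j)| +
      (dif (p j.+1) + dif (p j))))).
    apply: ler_sum => j _; rewrite -!difE.
    set g := update a v f.
    have -> : g (p j.+1) - g (p j) = (f (p j.+1) - f (p j)) +
        ((g (p j.+1) - f (p j.+1)) - (g (p j) - f (p j))).
      by rewrite opprB addrCA !subrKA.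
    rewrite (le_trans (ler_normD _ _))// lerD2l.
    by rewrite (le_trans (ler_normB _ _)).
  rewrite !big_split/= lerD2l lerD//; apply: le_trans sum_c.
    by rewrite big_ord_recl/= lerDr.
  by rewrite big_ord_recr/= lerDl.
by rewrite leeD2r//; apply: ereal_sup_ubound; exists m, p.
Qed.

End one_sided_limits.

(** * The evolution problem *)

Section evolution.
Context (R : realType) (H : completeNormedModType R).
Context (dot : {dot H for (@idfun R)}) (dotE : norm_induced_by dot).
Context (Z : set H) (T : R) (T0 : 0 < T).
Implicit Types (u y f z : R -> H).

(** {t} is a closed interval minus a half-open one; the interval extends to the
    left of t, or to the right when t = 0. *)
Lemma differential_measure_point f (Df : set (measurableTypeR R) -> H) t :
  differential_measure T f Df -> t \in `[0, T] ->
  Df [set t] = right_lim T f t - left_lim f t.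
Proof.
move=> [vDf _ _ Dfitv] tT; have := tT; rewrite in_itv/= => /andP[t0 tleT].
have i0 : 0 \in `[0, T] by rewrite in_itv/= lexx ltW.
have iT : T \in `[0, T] by rewrite in_itv/= lexx ltW.
move: t0; rewrite le_eqVlt => /predU1P[t0|t0].
  have [_ cc _ oc] := Dfitv 0 T i0 iT T0; rewrite -t0.
  have := @vmeasureU _ _ _ _ Df vDf [set 0] (`]0, T]%classic).
  rewrite setU1itv ?bnd_simp ?ltW// cc oc => /(_ _ _ _)/esym.
  move=> /(_ _ _ _)/(canRL (addrK _)) -> //.
    by rewrite opprB addrC subrKA.
  by apply/seteqP; split=> // x [/= ->]; rewrite in_itv/= ltxx.
have [_ cc co _] := Dfitv 0 t i0 tT t0.
have := @vmeasureU _ _ _ _ Df vDf (`[0, t[%classic) [set t].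
rewrite setUitv1 ?bnd_simp ?ltW// cc co => /(_ _ _ _)/esym.
move=> /(_ _ _ _)/(canRL (addKr _)) -> //.
  by rewrite opprB addrC subrKA.
by apply/seteqP; split=> // x [/= + xt]; rewrite xt in_itv/= ltxx andbF.
Qed.

(** At a discontinuity t of u, left continuity of u makes u(t) - y(t-) the limit
    of u(s) - y(s), which lie in Z; it is therefore its own projection. *)
Lemma solution_left_continuous u y : closed Z -> convex_set Z ->
  BV T u -> left_continuous T u -> BV T y ->
  (forall t, t \in `[0, T] -> Z (u t - y t)) ->
  (forall t, Discont T u t -> t != 0 -> u t - y t = Proj Z (u t - left_lim y t)) ->
  Cont T u `<=` Cont T y -> left_continuous T y.
Proof.
move=> Zcl Zcv uBV ulc yBV yZ yproj CuCy t tT.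
have [t0|t0] := eqVneq t 0; first by rewrite /left_lim t0 eqxx.
have [ut|ut] := pselect (Cont T u t); first exact: Cont_left_lim (CuCy _ ut).
have := yproj t (conj tT ut) t0.
have := tT; rewrite in_itv/= => /andP[t0' tleT].
have tgt0 : 0 < t by rewrite lt0r t0.
have u_t : u x @[x --> t^'-] --> u t.
  by have := ulc t tT; rewrite /left_lim (negbTE t0) => <-;
    exact: BV_left_cvg uBV tgt0 tleT.
have y_t : y x @[x --> t^'-] --> left_lim y t.
  by rewrite /left_lim (negbTE t0); exact: BV_left_cvg yBV tgt0 tleT.
rewrite (Proj_id dotE Zcl Zcv); first by move=> /addrI/oppr_inj.
apply: (closed_cvg Z Zcl _ _ (cvgB u_t y_t)).
apply: filterS2 (nbhs_left_gt tgt0) (nbhs_left_lt t) => x x0 xt.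
by apply: yZ; rewrite in_itv/= !ltW// (lt_le_trans xt).
Qed.

Lemma Cont_measurable f : (forall t, 0 <= t -> t < T -> cvg (f x @[x --> t^'+])) ->
  measurable (Cont T f : set (measurableTypeR R)).
Proof.
move=> fr; have -> : Cont T f = `[0, T] `\` Discont T f.
  by rewrite /Discont setDD; apply/esym/setIidPr => t [].
apply: measurableD => //; apply: countable_measurable => //.
exact: Discont_countable.
Qed.

(** [0, T] is cut by the continuity set of u: the integrand agrees on it with
    that of the hypothesis, and the rest is a countable sum of projection
    inequalities. *)
Lemma vintegral_right_limits_le0 u y (Dy : set (measurableTypeR R) -> H) :
  closed Z -> convex_set Z -> BV T u -> differential_measure T y Dy ->
  left_continuous T y -> Cont T u `<=` Cont T y ->
  (forall z, Linfty T z -> (forall t, t \in `[0, T] -> Z (z t)) ->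
     vintegral_on dot Dy (Cont T u) (fun t => z t - u t + y t) <= 0) ->
  (forall t, Discont T u t ->
     right_lim T u t - right_lim T y t = Proj Z (right_lim T u t - y t)) ->
  forall z, Linfty T z -> (forall t, t \in `[0, T] -> Z (z t)) ->
  vintegral_on dot Dy `[0, T] (fun t => z t - right_lim T u t + right_lim T y t) <= 0.
Proof.
move=> Zcl Zcv uBV DyE ylc CuCy ycont yproj z zL zZ.
have [vDy _ _ _] := DyE.
have ur t : 0 <= t -> t < T -> cvg (u x @[x --> t^'+]) by exact: BV_right_cvg.
pose g (t : R) := z t - right_lim T u t + right_lim T y t.
apply: (vintegral_case (P := fun I => I <= 0)) => // I gI.
have [J [K [hJ hK ->]]] := vintegral_split dotE vDy gI (Cont_measurable ur).
rewrite -[0]addr0 lerD//.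
  have <- := vintegralP dotE vDy hJ.
  have := ycont z zL zZ; congr (vintegral _ _ _ <= 0); apply/funext => t.
  rewrite scalerA !indicE; case: (boolP (t \in Cont T u)); last by rewrite mul0r !scale0r.
  move=> /set_mem ut; rewrite mul1r (mem_set (A := `[0, T])) ?scale1r; last exact: ut.1.
  by rewrite !Cont_right_lim//; exact: CuCy.
have m1 : forall x : measurableTypeR R, measurable [set x].
  by move=> x; exact: measurable_set1.
apply: (@vintegral_countable_le0 _ _ dot dotE _ (measurableTypeR R) Dy vDy g
  (Discont T u) K m1 (Discont_countable ur)).
  move=> t Dt; rewrite (differential_measure_point DyE Dt.1) (ylc t Dt.1).
  rewrite dotC; have := Proj_obtuse dotE Zcl Zcv (right_lim T u t - y t) (zZ t Dt.1).
  rewrite -(yproj t Dt); congr (dot _ _ <= 0).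
    by rewrite opprB addrC addrA subrK.
  by rewrite /g opprB addrA addrAC.
move: hK; congr is_vintegral; apply/funext => t; rewrite scalerA !indicE.
by rewrite -natrM mulnb -in_setI setIC.
Qed.

(** If Z contains a point other than 0, the value of y at a common continuity
    point a in ]0, T[ of u and y can be moved without leaving the solution set:
    one-sided limits, and so the differential measure and the jump conditions,
    do not see it.  In the variational inequality {a} has measure 0, and the test
    function is replaced at a by u(a) - y(a), which makes the original integrand
    vanish there. *)
Lemma only_solution_Cont_subset u (z0 : H) y (Dy : set (measurableTypeR R) -> H) :
  Z 0 -> BV T u -> BV T y -> differential_measure T y Dy ->
  solution dot Z T u z0 y Dy -> only_solution dot Z T u z0 y ->
  Cont T u `<=` Cont T y.
Proof.
move=> Z0 uBV yBV DyE [yZ yint yproj yproj' yinit] yonly.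
have [vDy finDy supDy itvDy] := DyE.
have [Z00|/existsNP[w0 /not_implyP[Zw0 /eqP w00]]] := pselect (forall w, Z w -> w = 0).
  have uy t : t \in `[0, T] -> u t = y t.
    by move=> /yZ/Z00/eqP; rewrite subr_eq0 => /eqP.
  move=> t [tT ut]; split=> //; rewrite -(uy t tT).
  apply: cvg_trans ut; apply: near_eq_cvg.
  by rewrite near_withinE; apply: nearW => x; exact: uy.
have BVr f : BV T f -> forall t, 0 <= t -> t < T -> cvg (f x @[x --> t^'+]).
  by move=> fBV t; exact: BV_right_cvg.
have [a [/andP[a0 aT] aD]] := itv_not_countable T0
  (countable_setU (Discont_countable (BVr _ uBV)) (Discont_countable (BVr _ yBV))).
have aiT : a \in `[0, T] by rewrite in_itv/= !ltW.
have ua : Cont T u a by apply: contrapT => nu; apply: aD; left.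
have ya : Cont T y a by apply: contrapT => ny; apply: aD; right.
have Dya : Dy [set a] = 0.
  by rewrite (differential_measure_point DyE aiT) (Cont_left_lim ya)
    (Cont_right_lim ya) subrr.
have [w Zw wa] : exists2 w, Z w & w != u a - y a.
  have [ua0|] := eqVneq (u a - y a) 0; first by exists w0; rewrite ?ua0.
  by rewrite eq_sym; exists 0.
have an0 : a != 0 by rewrite gt_eqF.
have anT : a != T by rewrite lt_eqF.
pose y' := update a (u a - w) y.
have y'E t : t != a -> y' t = y t by move=> ta; rewrite /y' /update (negbTE ta).
have y'a : y' a = u a - w by rewrite /y' /update eqxx.
have Dy'E : differential_measure T y' Dy.
  by split=> // c e cT eT ce; have := itvDy c e cT eT ce;
    rewrite !(left_lim_update _ _ _ an0) !(right_lim_update _ _ _ anT).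
suff y'sol : solution dot Z T u z0 y' Dy.
  have := yonly y' Dy (BV_update _ _ yBV) Dy'E y'sol a aiT.
  by rewrite y'a => uwy; move: wa; rewrite -uwy subKr eqxx.
split.
- move=> t tT; have [->|ta] := eqVneq t a; first by rewrite y'a subKr.
  by rewrite y'E//; exact: yZ.
- move=> z [zm [M zM]] zZ; apply: (vintegral_case (P := fun I => I <= 0)) => // I gI.
  have m1 : measurable [set a : measurableTypeR R] by exact: measurable_set1.
  have [J [K [hJ hK ->]]] := vintegral_split dotE vDy gI m1.
  rewrite (vintegral_point dotE vDy m1 hJ) Dya dot0r add0r.
  have <- := vintegralP dotE vDy hK.
  pose z' := update a (u a - y a) z.
  have z'L : Linfty T z'.
    split; first exact: strongly_measurable_update.
    exists (Num.max M `|u a - y a|) => t tT; rewrite /z' /update le_max.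
    by case: ifPn => _; rewrite ?lexx ?orbT ?zM.
  have z'Z t : t \in `[0, T] -> Z (z' t).
    move=> tT; rewrite /z' /update; case: ifPn => _; last exact: zZ.
    exact: yZ.
  have := yint z' z'L z'Z; congr (vintegral _ _ _ <= 0); apply/funext => t.
  rewrite scalerA !indicE in_setC in_set1 /z' /update.
  have [->|ta] := eqVneq t a; last by rewrite mul1r y'E.
  by rewrite mul0r scale0r [u a - y a]addrC addrK addNr scaler0.
- move=> t Dt t0; rewrite (left_lim_update _ _ _ an0) y'E; first exact: yproj.
  by apply: contraPneq Dt => -> -[_]; exact.
- move=> t Dt; rewrite (right_lim_update _ _ _ anT) y'E; first exact: yproj'.
  by apply: contraPneq Dt => -> -[_]; exact.
- by rewrite y'E// eq_sym.
Qed.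

End evolution.

Theorem theorem3p2 (R : realType) (H : completeNormedModType R)
    (dot : {dot H for (@idfun R)}) (dotE : norm_induced_by dot)
    (Z : set H) (Zclosed : closed Z) (Zconvex : convex_set Z) (Z0 : Z 0)
    (T : R) (T0 : 0 < T)
    (u : R -> H) (uBV : BV T u) (ulc : left_continuous T u)
    (z0 : H) (Zz0 : Z z0)
    (y : R -> H) (yBV : BV T y)
    (Dy : set (measurableTypeR R) -> H) (DyE : differential_measure T y Dy)
    (ysol : solution dot Z T u z0 y Dy)
    (yuniq : only_solution dot Z T u z0 y \/ Cont T u `<=` Cont T y) :
  left_continuous T y /\
  [/\ (forall t : R, t \in `[0, T] -> Z (u t - y t)),
      (forall z : R -> H, Linfty T z -> (forall t : R, t \in `[0, T] -> Z (z t)) ->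
        vintegral_on dot Dy `[0, T]
          (fun t : R => z t - right_lim T u t + right_lim T y t) <= 0) &
      u 0 - y 0 = z0].
Proof.
have CuCy : Cont T u `<=` Cont T y.
  by case: yuniq => // yonly; exact: only_solution_Cont_subset ysol yonly.
have [yZ yint yproj yproj' yinit] := ysol.
have ylc : left_continuous T y by exact: (solution_left_continuous dotE Zclosed Zconvex uBV ulc yBV).
by split=> //; split=> //; exact: (vintegral_right_limits_le0 dotE T0 Zclosed Zconvex uBV).
Qed.
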